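(* Let $\alpha>0$, $\beta>0$, $t\ge0$. For every integer $n\ge0$ the following hold, where $\beta_n$ is the off-diagonal recurrence coefficient and $R_n,R_n^*,r_n,r_n^*$ are the auxiliary quantities associated with the weight $w(x)=e^{-t/x}x^\alpha(1-x)^\beta$ on $[0,1]$, as defined in the context: $$(r^*_n)^2-t\,r^*_n=\beta_nR^*_nR^*_{n-1},$$ $$r_n^2+\beta r_n=\beta_nR_nR_{n-1},$$ $$(t-2r^*_n)(n-r_n)-\alpha r^*_n=\beta_n\left(R^*_nR_{n-1}+R^*_{n-1}R_n\right),$$ $$\sum_{j=0}^{n-1}R^*_j=n(t-\alpha-n)-(2n+\alpha+\beta)(r^*_n-r_n).$$
   Context: $w(x)=w(x;t)=e^{-t/x}x^\alpha(1-x)^\beta$ on $[0,1]$. $P_n$ is the monic polynomial of degree $n$ with $\int_0^1P_mP_nw\,dx=h_n\delta_{m,n}$. The recurrence coefficients $\alpha_n,\beta_n$ (not to be confused with the parameters $\alpha,\beta$) are defined by $xP_n(x)=P_{n+1}(x)+\alpha_nP_n(x)+\beta_nP_{n-1}(x)$, with $P_0=1$, $\beta_0P_{-1}=0$. Auxiliary quantities: $R_n^*:=\frac{t}{h_n}\int_0^1[P_n(y)]^2w(y)\frac{dy}{y}$, $R_n:=\frac{\beta}{h_n}\int_0^1[P_n(y)]^2w(y)\frac{dy}{1-y}$, $r_n^*:=\frac{t}{h_{n-1}}\int_0^1P_{n-1}(y)P_n(y)w(y)\frac{dy}{y}$, $r_n:=\frac{\beta}{h_{n-1}}\int_0^1P_{n-1}(y)P_n(y)w(y)\frac{dy}{1-y}$,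 with $r_0=r_0^*:=0$. For $n=0$, terms containing the factor $\beta_0$ and an index $-1$ are $0$ by convention, and the empty sum is $0$. *)

(* Defs.v *)
From mathcomp Require Import all_boot all_order all_algebra.
From mathcomp Require Import all_classical all_reals all_analysis.

Set Implicit Arguments.
Unset Strict Implicit.
Unset Printing Implicit Defensive.

Import Order.TTheory GRing.Theory Num.Theory.
Import numFieldNormedType.Exports.

Local Open Scope classical_set_scope.
Local Open Scope ring_scope.

(* The Lebesgue integral also covers the singularities of [w y / y] at [0] and
   of [w y / (1 - y)] at [1]. *)
Definition integral01 (R : realType) (f : R -> R) : R :=
  \int[@lebesgue_measure R]_(x in `[0, 1]) f x.

(* At [x = 0] the value is [0] when [alpha > 0]: there [- t / 0 = 0] and
   [0 `^ alpha = 0]. *)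
Definition weight (R : realType) (alpha beta t x : R) : R :=
  expR (- t / x) * x `^ alpha * (1 - x) `^ beta.

(* [previous u n] is [u (n - 1)], with [u (- 1)] read as [0]. *)
Definition previous (V : nmodType) (u : nat -> V) (n : nat) : V :=
  if n is m.+1 then u m else 0.

Definition monic_orthogonal (R : realType) (w : R -> R)
    (P : nat -> {poly R}) (h : nat -> R) : Prop :=
  [/\ forall n, P n \is monic,
      forall n, size (P n) = n.+1
    & forall m n,
        integral01 (fun x => (P m).[x] * (P n).[x] * w x) = h n * (m == n)%:R].

(* [previous P 0 = 0] renders the convention [b_0 P_(-1) = 0] and leaves [b 0]
   unconstrained. *)
Definition three_term_recurrence (R : realType) (P : nat -> {poly R})
    (a b : nat -> R) : Prop :=
  forall n, 'X * P n = P n.+1 + a n *: P n + b n *: previous P n.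

Definition Rstar (R : realType) (alpha beta t : R) (P : nat -> {poly R})
    (h : nat -> R) (n : nat) : R :=
  t / h n * integral01 (fun y => (P n).[y] ^+ 2 * weight alpha beta t y / y).

Definition Raux (R : realType) (alpha beta t : R) (P : nat -> {poly R})
    (h : nat -> R) (n : nat) : R :=
  beta / h n *
  integral01 (fun y => (P n).[y] ^+ 2 * weight alpha beta t y / (1 - y)).

Definition rstar (R : realType) (alpha beta t : R) (P : nat -> {poly R})
    (h : nat -> R) (n : nat) : R :=
  if n is m.+1 then
    t / h m *
    integral01 (fun y => (P m).[y] * (P n).[y] * weight alpha beta t y / y)
  else 0.

Definition raux (R : realType) (alpha beta t : R) (P : nat -> {poly R})
    (h : nat -> R) (n : nat) : R :=
  if n is m.+1 then
    beta / h m *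
    integral01
      (fun y => (P m).[y] * (P n).[y] * weight alpha beta t y / (1 - y))
  else 0.

(* Main.v *)
Require Import Defs.
From HB Require Import structures.
From mathcomp Require Import all_boot all_order all_algebra.
From mathcomp Require Import all_classical all_reals all_analysis.
From mathcomp Require Import measurable_realfun ring lra.

(** On polynomials put [L p = \int p w], [T p = t \int p w / y] and
[S p = beta \int p w / (1 - y)].  Integrating [(y p w)'] over [[0, 1]] gives
[L (p + 'X p') + T p + (alpha + beta) L p = S p], while [T ('X p) = t L p] and
[S ((1 - 'X) p) = beta L p]; everything else is algebra.

Splitting [q = q(0) + 'X q1], orthogonality gives [T (P_n q) = q(0) T P_n] when
[deg q <= n], and [T (P_n P_(n-1)) = P_n(0) T P_(n-1) + t h_(n-1)]; the same
holds for [S] at the point [1], with [- beta] for [t].  Multiplying the two expressions of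
[T (P_n P_(n-1))], resp. [S (P_n P_(n-1))], yields the two quadratic identities.

Expanding ['X P_m' - m P_m] in the basis [(P_j)] and evaluating at [0] expresses
[m P_m(0)] through the kernel [K_m(u, v) = \sum_(j < m) P_j(u) P_j(v) / h_j] at
[(0, 1)] and [(0, 0)].  Take [m = n] and [m = n - 1], where [K_(n-1)] is [K_n]
minus one explicit term; eliminating [K_n(0, 0)] and computing [K_n(0, 1)] by
Christoffel-Darboux gives the mixed identity.

Finally [r_n - r*_n] is minus the subleading coefficient of [P_n], and applying
the integrated identity to [(1 - 'X) P_n ^ 2] gives [R*_n] in terms of these
coefficients, so that the sum telescopes. *)

Set Implicit Arguments.
Unset Strict Implicit.
Unset Printing Implicit Defensive.

Import Order.TTheory GRing.Theory Num.Theory.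
Import numFieldNormedType.Exports.

Local Open Scope ring_scope.

(** * Orthogonal polynomials *)

Section OrthogonalPolynomials.
Variables (R : fieldType) (L : {scalar {poly R}}) (P : nat -> {poly R}).
Variables (h a b : nat -> R).
Implicit Types p q : {poly R}.
Hypothesis P_monic : forall n, P n \is monic.
Hypothesis size_P : forall n, size (P n) = n.+1.
Hypothesis orthP : forall m n, L (P m * P n) = h n * (m == n)%:R.
Hypothesis h_neq0 : forall n, h n != 0.
Hypothesis recP :
  forall n, 'X * P n = P n.+1 + a n *: P n + b n *: previous P n.

Lemma coefPn n : (P n)`_n = 1.
Proof. by have /monicP := P_monic n; rewrite lead_coefE size_P. Qed.

(** Since [P n] is monic of degree [n], the subtraction cancels the top coefficient. This is the
    descent step of the degree inductions below. *)
Lemma size_sub_lead n q : (size q <= n.+1)%N -> (size (q - q`_n *: P n)%R <= n)%N.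
Proof.
move=> sq; apply/leq_sizeP => j; rewrite leq_eqVlt coefB coefZ => /predU1P[<-|nj].
  by rewrite coefPn mulr1 subrr.
by rewrite (nth_default _ (leq_trans sq nj)) [(P n)`_j]nth_default ?size_P // mulr0 subrr.
Qed.

Lemma orth_lt n q : (size q <= n)%N -> L (P n * q) = 0.
Proof.
(* The degree bound is separated from [n], so that the induction can peel off [P k] for [k < n]
   while [P n] stays fixed. *)
suff orth_lt_le k : (k <= n)%N -> forall q : {poly R}, (size q <= k)%N -> L (P n * q) = 0.
  exact: orth_lt_le.
elim: k => [_ {}q|k IH kn {}q sq].
  by rewrite leqn0 size_poly_eq0 => /eqP ->; rewrite mulr0 linear0.
rewrite -[q](subrK (q`_k *: P k)) mulrDr linearD (IH (ltnW kn)) ?size_sub_lead //.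
by rewrite -scalerAr linearZ /= orthP gtn_eqF // mulr0 mulr0 addr0.
Qed.

Lemma orth_le n q : (size q <= n.+1)%N -> L (P n * q) = q`_n * h n.
Proof.
move=> sq; rewrite -[in LHS](subrK (q`_n *: P n) q) mulrDr linearD.
rewrite orth_lt ?size_sub_lead // add0r.
by rewrite -scalerAr linearZ /= orthP eqxx mulr1.
Qed.

Lemma size_Xderiv n : (size ('X * (P n)^`())%R <= n.+1)%N.
Proof.
apply/leq_sizeP => j; rewrite coefXM; case: j => // j nj /=.
by rewrite coef_deriv nth_default ?mul0rn // size_P.
Qed.

Lemma coef_Xderiv (p : {poly R}) j : ('X * p^`())`_j = p`_j *+ j.
Proof. by rewrite coefXM; case: j => [|j] //=; rewrite ?mulr0n // coef_deriv. Qed.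

Lemma orth_square n : L (P n * P n) = h n.
Proof. by rewrite orthP eqxx mulr1. Qed.

Lemma orth_neighbour n : L (P n.+1 * P n) = 0.
Proof. by rewrite orth_lt // size_P. Qed.

(** Pair the recurrence for [P n.+1] with [P n]: only the [b] term survives on the right. On the
    left ['X] moves to the other factor, and ['X * P n] is monic of degree [n.+1]. *)
Lemma recurrence_b n : b n.+1 = h n.+1 / h n.
Proof.
have /(congr1 (fun q => L (P n * q))) := recP n.+1.
rewrite /= !mulrDr !linearD /= -!scalerAr !linearZ /= orth_square !orthP.
rewrite [n == _]ltn_eqF // [n == _]ltn_eqF // !mulr0 !add0r.
have -> : P n * ('X * P n.+1) = P n.+1 * ('X * P n) by ring.
rewrite orth_le; last by rewrite mulrC size_mulX ?size_P // monic_neq0.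
by rewrite coefXM /= coefPn mul1r => ->; rewrite mulfK.
Qed.

(* The coefficient of ['X^(n-1)] in [P n], and [0] for [n = 0]. *)
Definition subleading n := ('X * P n)`_n.

Lemma recurrence_a n : a n = subleading n - subleading n.+1.
Proof.
rewrite /subleading recP !coefD !coefZ coefPn coefXM /=.
suff -> : (previous P n)`_n = 0 by ring.
by case: n => [|n] /=; rewrite ?coef0 // nth_default // size_P.
Qed.

Lemma orth_Xderiv n : L (P n * ('X * (P n)^`())) = n%:R * h n.
Proof. by rewrite orth_le ?size_Xderiv // coef_Xderiv coefPn. Qed.

Lemma orth_Xderiv_lt n : L (P n.+1 * ('X * (P n)^`())) = 0.
Proof. by rewrite orth_lt ?size_Xderiv. Qed.

Lemma size_Xderiv_sub n : (size ('X * (P n)^`() - n%:R *: P n)%R <= n)%N.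
Proof.
have := size_sub_lead (size_Xderiv n).
by rewrite coef_Xderiv coefPn.
Qed.

(** The operator ['X * d/dX] multiplies the coefficient of ['X^j] by [j]. After removing [n.+1]
    times [P n.+1], the coefficient of ['X^n] is multiplied by [n - (n + 1) = -1]. *)
Lemma orth_Xderiv_gt n :
  L (P n * ('X * (P n.+1)^`())) = - subleading n.+1 * h n.
Proof.
rewrite -[X in P n * X](subrK (n.+1%:R *: P n.+1)) mulrDr linearD.
rewrite orth_le ?size_Xderiv_sub // coefB coef_Xderiv coefZ /subleading coefXM /=.
rewrite -scalerAr linearZ /= (orthP n) ltn_eqF // -[_ *+ n]mulr_natl -(natr1 n) mulr0n.
by ring.
Qed.

Lemma orth_X n : L ('X * (P n * P n)) = a n * h n.
Proof.
rewrite mulrA recP !mulrDl -!scalerAl !linearD !linearZ /=.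
rewrite orth_neighbour orth_square.
suff -> : L (previous P n * P n) = 0 by rewrite /GRing.scale /=; ring.
case: n => [|n] /=; first by rewrite mul0r linear0.
by rewrite mulrC orth_neighbour.
Qed.

Lemma orth_XXderiv n :
  L ('X * (P n * ('X * (P n)^`()))) = (n%:R * a n - subleading n) * h n.
Proof.
rewrite mulrA recP !mulrDl -!scalerAl !linearD !linearZ /=.
rewrite orth_Xderiv_lt orth_Xderiv /GRing.scale /=.
case: n => [|n] /=.
  by rewrite /subleading (mul0r ('X * _)) linear0 coefXM /= mulr0n; ring.
(* The [b] term contributes [- b n.+1 * subleading n.+1 * h n], and [b n.+1 * h n = h n.+1]. *)
by rewrite orth_Xderiv_gt recurrence_b; field; exact: h_neq0.
Qed.

(** * The Christoffel-Darboux kernel and orthogonal expansions *)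

Definition cd_kernel n (u v : R) :=
  \sum_(0 <= j < n) (P j).[u] * (P j).[v] / h j.

Lemma cd_kernelS n u v :
  cd_kernel n.+1 u v = cd_kernel n u v + (P n).[u] * (P n).[v] / h n.
Proof. by rewrite /cd_kernel big_nat_recr. Qed.

Lemma hornerP_rec n u :
  u * (P n).[u] = (P n.+1).[u] + a n * (P n).[u] + b n * (previous P n).[u].
Proof. by have /(congr1 (horner^~ u)) := recP n; rewrite !hornerE. Qed.

(** By induction: eliminating [P n.+2] through the recurrence cancels its [a] terms, and
    [b n.+1 / h n.+1 = 1 / h n] turns its [b] terms into the right-hand side at the previous
    index. *)
Lemma christoffel_darboux n u v :
  (u - v) * cd_kernel n.+1 u v =
  ((P n.+1).[u] * (P n).[v] - (P n).[u] * (P n.+1).[v]) / h n.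
Proof.
elim: n => [|n IH]; rewrite cd_kernelS mulrDr.
  have -> : cd_kernel 0 u v = 0 by rewrite /cd_kernel big_nil.
  have := hornerP_rec 0 u; have := hornerP_rec 0 v => /=; rewrite !horner0 => Hv Hu.
  have -> : (P 1).[u] = u * (P 0).[u] - a 0 * (P 0).[u] by rewrite Hu; ring.
  have -> : (P 1).[v] = v * (P 0).[v] - a 0 * (P 0).[v] by rewrite Hv; ring.
  by field; exact: h_neq0.
rewrite IH; have := hornerP_rec n.+1 u; have := hornerP_rec n.+1 v => /=.
rewrite recurrence_b => Hv Hu.
have -> : (P n.+2).[u] = u * (P n.+1).[u] - a n.+1 * (P n.+1).[u]
    - h n.+1 / h n * (P n).[u] by rewrite Hu; ring.
have -> : (P n.+2).[v] = v * (P n.+1).[v] - a n.+1 * (P n.+1).[v]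
    - h n.+1 / h n * (P n).[v] by rewrite Hv; ring.
by field; rewrite !h_neq0.
Qed.

Lemma orth_expansion n q u : (size q <= n)%N ->
  q.[u] = \sum_(0 <= j < n) L (P j * q) * (P j).[u] / h j.
Proof.
elim: n q => [|n IH] q sq.
  by rewrite big_nil; move: sq; rewrite leqn0 size_poly_eq0 => /eqP ->; rewrite horner0.
rewrite big_nat_recr //= orth_le //.
rewrite -[in LHS](subrK (q`_n *: P n) q) hornerD IH ?size_sub_lead // hornerZ.
congr (_ + _); last by field; exact: h_neq0.
rewrite !big_nat; apply: eq_bigr => j /= jn.
rewrite mulrBr linearB -scalerAr linearZ /= orthP ltn_eqF //.
by rewrite !mulr0 subr0.
Qed.

(** * The singular functionals [T] and [S], and the four identities *)

Variables (T S : {scalar {poly R}}) (t alpha beta : R).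
Hypothesis T_X : forall p, T ('X * p) = t * L p.
Hypothesis S_1X : forall p, S ((1 - 'X) * p) = beta * L p.
Hypothesis pearson :
  forall p, L (p + 'X * p^`()) + T p + (alpha + beta) * L p = S p.

(** Division by the monic ['X - u%:P] preserves the top coefficient; it is recorded because
    [T_evalS] and [S_evalS] need it. For [n = 0] the quotient is zero, whence the separate case. *)
Lemma polynomial_split (p : {poly R}) u n : (size p <= n.+1)%N ->
  exists2 q : {poly R}, p = p.[u]%:P + ('X - u%:P) * q
    & (size q <= n)%N /\ q`_n.-1 = if n is 0 then 0 else p`_n.
Proof.
move=> sp.
have /factor_theorem[q Hq] : root (p - p.[u]%:P) u.
  by rewrite /root !hornerE subrr.
exists q; first by rewrite mulrC -Hq; ring.
have sq : (size q <= n)%N.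
  have := leq_trans (size_polyD p (- p.[u]%:P)) _.
  move=> /(_ n.+1); rewrite geq_max sp size_polyN => /(_ _)/=.
  rewrite (leq_trans (size_polyC_leq1 _)) // => /(_ isT).
  rewrite Hq; have [->|q0] := eqVneq q 0; first by rewrite size_poly0.
  by rewrite size_proper_mul ?size_XsubC ?addn2 //= lead_coefXsubC mulr1 lead_coef_eq0.
split=> //; case: n sp sq => [|n] sp sq /=.
  by rewrite nth_default.
have /(congr1 (fun r : {poly R} => r`_n.+1)) := Hq.
rewrite coefB coefC /= subr0 mulrBr coefB coefMX coefMC /= => ->.
by rewrite [q`_n.+1]nth_default // mul0r subr0.
Qed.

Lemma T_eval n q : (size q <= n.+1)%N -> T (P n * q) = q.[0] * T (P n).
Proof.
move=> /(polynomial_split 0)[r Hq [sr _]].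
rewrite {1}Hq subr0 mulrDr linearD.
have -> : P n * ('X * r) = 'X * (P n * r) by ring.
by rewrite T_X orth_lt // mulr0 addr0 mulrC mul_polyC linearZ.
Qed.

Lemma S_eval n q : (size q <= n.+1)%N -> S (P n * q) = q.[1] * S (P n).
Proof.
move=> /(polynomial_split 1)[r Hq [sr _]].
rewrite {1}Hq mulrDr linearD.
(* [S] absorbs [1 - 'X], not ['X - 1]; this sign is why [- beta] takes the place of [t] in
   [S_evalS]. *)
have -> : P n * (('X - 1%:P) * r) = - ((1 - 'X) * (P n * r)) by rewrite polyC1; ring.
by rewrite linearN /= S_1X orth_lt // mulr0 oppr0 addr0 mulrC mul_polyC linearZ.
Qed.

Lemma T_evalS n : T (P n.+1 * P n) = (P n.+1).[0] * T (P n) + t * h n.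
Proof.
have [|r Hq [sr r_lead]] := @polynomial_split (P n.+1) 0 n.+1; first by rewrite size_P.
rewrite mulrC {1}Hq subr0 mulrDr linearD.
have -> : P n * ('X * r) = 'X * (P n * r) by ring.
rewrite T_X orth_le // r_lead coefPn mul1r; congr (_ + _).
by rewrite mulrC mul_polyC linearZ.
Qed.

Lemma S_evalS n : S (P n.+1 * P n) = (P n.+1).[1] * S (P n) - beta * h n.
Proof.
have [|r Hq [sr r_lead]] := @polynomial_split (P n.+1) 1 n.+1; first by rewrite size_P.
rewrite mulrC {1}Hq mulrDr linearD.
have -> : P n * (('X - 1%:P) * r) = - ((1 - 'X) * (P n * r)) by rewrite polyC1; ring.
rewrite linearN /= S_1X orth_le // r_lead coefPn mul1r; congr (_ + _).
by rewrite mulrC mul_polyC linearZ.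
Qed.

(** The prefactors [t] and [beta] of the auxiliary quantities are already contained in [T] and
    [S]. *)
Let Rs n := T (P n * P n) / h n.
Let Ra n := S (P n * P n) / h n.
Let rs n := if n is m.+1 then T (P n * P m) / h m else 0.
Let ra n := if n is m.+1 then S (P n * P m) / h m else 0.

Lemma T_square n : T (P n * P n) = (P n).[0] * T (P n).
Proof. by rewrite T_eval // size_P. Qed.

Lemma S_square n : S (P n * P n) = (P n).[1] * S (P n).
Proof. by rewrite S_eval // size_P. Qed.

(** Here the factor of lower degree is evaluated, whereas [T_evalS] evaluates the other one;
    comparing the two expressions is what produces relations. *)
Lemma T_next n : T (P n.+1 * P n) = (P n).[0] * T (P n.+1).
Proof. by rewrite T_eval // size_P. Qed.

Lemma S_next n : S (P n.+1 * P n) = (P n).[1] * S (P n.+1).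
Proof. by rewrite S_eval // size_P. Qed.

Lemma rstar_quadratic n : rs n ^+ 2 - t * rs n = b n * Rs n * previous Rs n.
Proof.
case: n => [|n] /=; first by ring.
rewrite /Rs recurrence_b /rs !T_square.
have E : T (P n.+1 * P n) - t * h n = (P n.+1).[0] * T (P n) by rewrite T_evalS; ring.
(* Factor as [rs * (rs - t)]: [T_next] rewrites the first factor and [E] the second, and the four
   resulting values regroup into the two squares. *)
have -> : (T (P n.+1 * P n) / h n) ^+ 2 - t * (T (P n.+1 * P n) / h n)
  = T (P n.+1 * P n) / h n * ((T (P n.+1 * P n) - t * h n) / h n).
  by field; exact: h_neq0.
by rewrite E T_next; field; rewrite !h_neq0.
Qed.

Lemma raux_quadratic n : ra n ^+ 2 + beta * ra n = b n * Ra n * previous Ra n.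
Proof.
case: n => [|n] /=; first by ring.
rewrite /Ra recurrence_b /ra !S_square.
have E : S (P n.+1 * P n) + beta * h n = (P n.+1).[1] * S (P n) by rewrite S_evalS; ring.
have -> : (S (P n.+1 * P n) / h n) ^+ 2 + beta * (S (P n.+1 * P n) / h n)
  = S (P n.+1 * P n) / h n * ((S (P n.+1 * P n) + beta * h n) / h n).
  by field; exact: h_neq0.
by rewrite E S_next; field; rewrite !h_neq0.
Qed.

Lemma Raux_sub_Rstar n : Ra n - Rs n = n%:R *+ 2 + 1 + alpha + beta.
Proof.
have := pearson (P n * P n).
rewrite derivM mulrDr !linearD /=.
have -> : 'X * ((P n)^`() * P n) = P n * ('X * (P n)^`()) by ring.
have -> : 'X * (P n * (P n)^`()) = P n * ('X * (P n)^`()) by ring.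
rewrite orth_Xderiv orth_square /Ra /Rs => <-.
by field; exact: h_neq0.
Qed.

(** In [pearson] for [P n.+1 * P n], orthogonality removes every [L] term except the one with the
    derivative of [P n.+1]. *)
Lemma raux_sub_rstar n : ra n - rs n = - subleading n.
Proof.
case: n => [|n]; first by rewrite /subleading coefXM /= subrr oppr0.
have := pearson (P n.+1 * P n).
rewrite derivM mulrDr !linearD /=.
have -> : 'X * ((P n.+1)^`() * P n) = P n * ('X * (P n.+1)^`()) by ring.
have -> : 'X * (P n.+1 * (P n)^`()) = P n.+1 * ('X * (P n)^`()) by ring.
rewrite orth_Xderiv_gt orth_Xderiv_lt orth_neighbour /= => <-.
by field; exact: h_neq0.
Qed.

Lemma evaluated_ladder n :
  - n%:R * (P n).[0] =
  S (P n) * cd_kernel n 0 1 - T (P n) * cd_kernel n 0 0.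
Proof.
have := orth_expansion 0 (size_Xderiv_sub n); rewrite !hornerE /= => E.
have -> : - n%:R * (P n).[0] = - (n%:R * (P n).[0]) by ring.
move: E; rewrite ?mul0r ?add0r ?sub0r => ->.
rewrite /cd_kernel !mulr_sumr -sumrB !big_nat; apply: eq_bigr => j /= jn.
have -> : L (P j * ('X * (P n)^`() - n%:R *: P n)) =
   (P j).[1] * S (P n) - (P j).[0] * T (P n).
  rewrite mulrBr linearB /= -scalerAr linearZ /= orthP ltn_eqF // !mulr0 subr0.
  have sj : (size (P j) <= n.+1)%N by rewrite size_P ltnS ltnW.
  rewrite -S_eval // -T_eval // -pearson !linearD /= derivM mulrDr linearD /=.
  have -> : 'X * ((P n)^`() * P j) = P j * ('X * (P n)^`()) by ring.
  have -> : 'X * (P n * (P j)^`()) = P n * ('X * (P j)^`()) by ring.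
  rewrite (orth_lt (n := n) (q := P j)) ?size_P //.
  rewrite (orth_lt (n := n) (q := _ * _)); first by ring.
  by apply: leq_trans (size_Xderiv j) _.
by ring.
Qed.

Lemma mixed_identity n :
  (t - 2 * rs n) * (n%:R - ra n) - alpha * rs n =
  b n * (Rs n * previous Ra n + previous Rs n * Ra n).
Proof.
case: n => [|n] /=; first by ring.
have E1 := evaluated_ladder n.+1.
have E0 := evaluated_ladder n.
have CD := christoffel_darboux n 0 1.
have D := Raux_sub_Rstar n.
move: E1 E0 CD D.
have Ts := T_evalS n; have Tn := T_next n.
have Ss := S_evalS n; have Sn := S_next n.
rewrite /Ra /Rs /rs /ra recurrence_b !T_square !S_square Tn Sn.
move: Ts Ss; rewrite Tn Sn => Ts Ss.
rewrite !cd_kernelS.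
move: (cd_kernel n 0 1) (cd_kernel n 0 0) => k01 k00.
have := h_neq0 n; have := h_neq0 n.+1.
move: Ts Ss; rewrite -natr1.
(* From here on only scalars matter: [A], [C] are values at 0 and 1, [x], [z] values of [T] and [S],
   [H] a norm; primed letters have index [n], unprimed ones [n.+1]. *)
move: ((P n.+1).[0]) ((P n).[0]) ((P n.+1).[1]) ((P n).[1]) (T (P n.+1))
  (T (P n)) (S (P n.+1)) (S (P n)) (h n) (h n.+1) (n%:R)
  => A A' C C' x x' z z' H' H N.
move=> Ts Ss H0 H'0 E1 E0 CD D.
(* The off-diagonal kernel and the three parameters are solved for in terms of these scalars,
   leaving a single rational relation [E]. *)
have k01E : k01 = - (A * C') / H'  + A' * C / H' - A' * C' / H'.
  apply: (canRL (addrK _)).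
  have -> : k01 + A' * C' / H' = - ((0 - 1) * (k01 + A' * C' / H')) by ring.
  by rewrite CD; field.
have tE : t = (A' * x - A * x') / H' by rewrite Ts; field.
have betaE : beta = (C * z' - C' * z) / H' by rewrite Ss; field.
have alphaE : alpha = C' * z' / H' - A' * x' / H' - (N *+ 2 + 1 + beta).
  by rewrite D; ring.
(* [x' * E1 - x * E0], where the diagonal kernel [k00] cancels. *)
have E : x' * (- (N + 1) * A) - x' * (z * (k01 + A' * C' / H')) +
    x * (z' * k01 + N * A') + x * x' * A' * A' / H' = 0.
  rewrite E1.
  have -> : z' * k01 + N * A' = z' * k01 - (- N * A') by ring.
  rewrite E0.
  by ring.
apply/eqP; rewrite -subr_eq0; apply/eqP.
(* After substitution, the difference of the two sides is the left side of [E] divided by [h n]. *)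
rewrite -[RHS](mulr0 H'^-1) -E alphaE betaE tE k01E.
by field; rewrite ?H0 ?H'0.
Qed.

Lemma sum_Rstar n :
  \sum_(0 <= j < n) Rs j =
  n%:R * (t - alpha - n%:R) - (2 * n%:R + alpha + beta) * (rs n - ra n).
Proof.
have -> : rs n - ra n = subleading n by rewrite -[LHS]opprB raux_sub_rstar opprK.
elim: n => [|n IH].
  by rewrite big_nil /subleading coefXM /=; ring.
rewrite big_nat_recr //= IH.
have Sp : S ((1 - 'X) * (P n * P n)) = beta * h n by rewrite S_1X orth_square.
have := pearson ((1 - 'X) * (P n * P n)); rewrite Sp.
rewrite !derivM derivB derivX -[1]polyC1 derivC polyC1.
have -> : (1 - 'X) * (P n * P n) + 'X * ((0 - 1) * (P n * P n)
      + (1 - 'X) * ((P n)^`() * P n + P n * (P n)^`())) =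
    P n * P n - ('X * (P n * P n)) *+ 2 + (P n * ('X * (P n)^`())) *+ 2
      - ('X * (P n * ('X * (P n)^`()))) *+ 2 by ring.
have -> : (1 - 'X) * (P n * P n) = P n * P n - 'X * (P n * P n) by ring.
have LB p q : L (p - q) = L p - L q by exact: linearB.
have TB p q : T (p - q) = T p - T q by exact: linearB.
rewrite !(LB, TB, linearD) /= T_X.
rewrite orth_square orth_X orth_Xderiv orth_XXderiv.
move=> E.
(* [T (P n * P n) - t * h n] is [T ((1 - 'X) * (P n * P n))], the combination that [E]
   determines. *)
have -> : Rs n = (T (P n * P n) - t * h n) / h n + t by rewrite /Rs; field; exact: h_neq0.
have -> : T (P n * P n) - t * h n = beta * h n
    - (h n - a n * h n *+ 2 + n%:R * h n *+ 2
       - (n%:R * a n - subleading n) * h n *+ 2)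
    - (alpha + beta) * (h n - a n * h n) by rewrite -E; ring.
by rewrite recurrence_a -natr1; field; exact: h_neq0.
Qed.
End OrthogonalPolynomials.

(** * The fundamental theorem of calculus on an open interval *)

Section ImproperFTC.
Local Open Scope classical_set_scope.
Local Open Scope ring_scope.
Variable R : realType.
Notation mu := (@lebesgue_measure R).
Implicit Types f F : R -> R.

(** A compact exhaustion of the open unit interval; the shift by 3 makes already the first member,
    from 1/3 to 2/3, nondegenerate. *)
Definition inner_itv (k : nat) : set R := `[k.+3%:R^-1, 1 - k.+3%:R^-1].

Lemma inner_itv_lt k : k.+3%:R^-1 < 1 - k.+3%:R^-1 :> R.
Proof.
have : k.+3%:R^-1 <= 3^-1 :> R by rewrite lef_pV2 ?posrE ?ltr0n // ler_nat.
by move: (k.+3%:R^-1) => e; lra.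
Qed.

Lemma inner_itv_sub k : inner_itv k `<=` `]0, 1[.
Proof.
move=> x; rewrite /inner_itv /= !in_itv /= => /andP[kx xk].
have k0 : 0 < k.+3%:R^-1 :> R by rewrite invr_gt0 ltr0n.
by rewrite (lt_le_trans k0 kx) (le_lt_trans xk) // gtrBl.
Qed.

Lemma inner_itv_mono : nondecreasing_seq inner_itv.
Proof.
move=> m n mn; rewrite subsetEset => x; rewrite /inner_itv /= !in_itv /= => /andP[mx xm].
have : n.+3%:R^-1 <= m.+3%:R^-1 :> R by rewrite lef_pV2 ?posrE ?ltr0n // ler_nat.
by move=> nm; rewrite (le_trans nm mx) (le_trans xm) // lerB.
Qed.

Lemma near_inner_itv (x : R) : x \in `]0, 1[ ->
  \forall k \near \oo, inner_itv k x.
Proof.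
rewrite in_itv /= => /andP[x0 x1].
have small (e : R) : 0 < e -> \forall k \near \oo, k.+3%:R^-1 <= e.
  move=> e0; have := near_infty_natSinv_lt (PosNum e0).
  apply: filterS => k /= /ltW; apply: le_trans.
  by rewrite lef_pV2 ?posrE ?ltr0n // ler_nat -addn2 leq_addr.
near=> k; rewrite /inner_itv /= in_itv /=; apply/andP; split.
  by near: k; exact: small.
by rewrite lerBrDr addrC -lerBrDr; near: k; apply: small; rewrite subr_gt0.
Unshelve. all: by end_near. Qed.

Lemma bigcup_inner_itv : \bigcup_k inner_itv k = `]0, 1[%classic.
Proof.
apply/seteqP; split => [x [k _]|x x01]; first exact: inner_itv_sub.
have [k _ xk] := near_inner_itv x01.
by exists k => //; apply: xk => /=.
Qed.

Lemma measurable_inner_itv k : measurable (inner_itv k).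
Proof. exact: measurable_itv. Qed.

Lemma integrable_oo_cc (g : R -> \bar R) :
  mu.-integrable `]0, 1[ g -> mu.-integrable `[0, 1] g.
Proof.
move=> /integrableP[mg gi]; apply/integrableP; split.
  exact: emeasurable_fun_itv_cc mg.
by rewrite integral_itv_bndoo //; exact: measurableT_comp.
Qed.

Section FTC.
Variables f F : R -> R.
Hypothesis cf : {in `]0, 1[, continuous f}.
Hypothesis dF : {in `]0, 1[, forall x : R, is_derive x 1 F (f x)}.
Hypothesis F0 : F x @[x --> 0^'+] --> F 0.
Hypothesis F1 : F x @[x --> 1^'-] --> F 1.

Lemma integral_inner_itv k :
  (\int[mu]_(x in inner_itv k) (f x)%:E =
   (F (1 - k.+3%:R^-1))%:E - (F k.+3%:R^-1)%:E)%E.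
Proof.
have sub (x : R) : x \in `[k.+3%:R^-1, 1 - k.+3%:R^-1] -> x \in `]0, 1[.
  exact: (@inner_itv_sub k x).
have cF (x : R) : x \in `]0, 1[ -> {for x, continuous F}.
  by move=> /dF[dFx _]; apply/differentiable_continuous/derivable1_diffP.
have lt := inner_itv_lt k.
apply: continuous_FTC2 => //.
- apply: continuous_in_subspaceT => x; rewrite inE => xk.
  by apply: cf; exact: sub.
- split.
  + move=> x xk; have [] // := dF (x := x).
    by apply: sub; exact: subset_itv_oo_cc xk.
  + apply: cvg_at_right_filter; apply: cF; apply: sub.
    by rewrite in_itv /= lexx ltW.
  + apply: cvg_at_left_filter; apply: cF; apply: sub.
    by rewrite in_itv /= lexx ltW.
- move=> x xk; rewrite derive1E; apply: derive_val.
  by apply: dF; apply: sub; exact: subset_itv_oo_cc xk.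
Qed.

Lemma cvg_integral_inner_itv :
  (\int[mu]_(x in inner_itv k) (f x)%:E @[k --> \oo] --> (F 1 - F 0)%:E)%E.
Proof.
under eq_fun do rewrite integral_inner_itv -EFinB.
have inv0 : (k.+3%:R^-1 : R) @[k --> \oo] --> 0.
  have := @cvg_harmonic R; rewrite -(cvg_shiftn 2).
  by under eq_fun do rewrite /= addn2.
have ? k : 0 < k.+3%:R^-1 :> R by rewrite invr_gt0 ltr0n.
apply: cvg_EFin; first exact: nearW.
apply: cvgB.
- have /cvg_at_leftP := F1; apply; split => [k|]; first by rewrite ltrBlDr ltrDl.
  by rewrite -[X in _ --> X]subr0; apply: cvgB => //; exact: cvg_cst.
- by have /cvg_at_rightP := F0; apply.
Qed.

Lemma measurable_fun_oo : measurable_fun (`]0, 1[ : set R) f.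
Proof.
apply: open_continuous_measurable_fun; first exact: interval_open.
by move=> x; rewrite inE => x01; exact: cf.
Qed.

(** By monotone convergence the integral is the limit of those over the compact intervals, which is
    the finite number [F 1 - F 0]. *)
Lemma ge0_derivative_integrable : {in `]0, 1[, forall x, 0 <= f x} ->
  mu.-integrable `]0, 1[ (EFin \o f).
Proof.
move=> f0; apply/integrableP; split.
  by apply/measurable_EFinP; exact: measurable_fun_oo.
under eq_integral => x.
  rewrite inE /= => x01; rewrite ger0_norm ?f0 //; over.
have lim : (\int[mu]_(x in inner_itv k) (f x)%:E @[k --> \oo] -->
    \int[mu]_(x in (`]0%R, 1%R[ : set R)) (f x)%:E)%E.
  rewrite -bigcup_inner_itv; apply: ge0_nondecreasing_set_cvg_integral.
  - exact: inner_itv_mono.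
  - exact: measurable_inner_itv.
  - move=> k; apply/measurable_EFinP.
    by apply: measurable_funS measurable_fun_oo => //; exact: inner_itv_sub.
  - by move=> k x /inner_itv_sub; rewrite lee_fin; exact: f0.
by rewrite (cvg_unique _ lim cvg_integral_inner_itv) ?ltry.
Qed.

Lemma improper_FTC : mu.-integrable (`]0, 1[ : set R) (EFin \o f) ->
  (\int[mu]_(x in (`]0%R, 1%R[ : set R)) (f x)%:E = (F 1 - F 0)%:E)%E.
Proof.
move=> fi; have mf := measurable_int _ fi.
have mi k : measurable_fun (`]0, 1[ : set R) ((EFin \o f) \_ (inner_itv k)).
  apply/measurable_restrict => //; first exact: measurable_inner_itv.
  by apply: measurable_funS mf => //; exact: subIsetr.
have lim : (\int[mu]_(x in inner_itv k) (f x)%:E @[k --> \oo] -->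
    \int[mu]_(x in (`]0%R, 1%R[ : set R)) (f x)%:E)%E.
  (* The restrictions of [f] to the inner intervals are dominated by the absolute value of [f]
     itself. *)
  have [||_ _] := @dominated_convergence _ (measurableTypeR R) R mu (`]0, 1[ : set R)
    (measurable_itv _) _ _ _ mi mf _ (integrable_abse fi).
  - apply: aeW => /= x x01; apply: cvg_near_cst.
    have := near_inner_itv x01; apply: filterS => k xk.
    by rewrite patchE mem_set.
  - apply: aeW => /= x k _; rewrite patchE; case: ifPn => // _.
    by rewrite abse0 lee_fin normr_ge0.
  - apply: cvg_trans; apply: near_eq_cvg; near=> k.
    rewrite /= -integral_mkcondl; congr integral.
    by apply: setIidl; exact: inner_itv_sub.
exact: cvg_unique lim cvg_integral_inner_itv.
Unshelve. all: by end_near. Qed.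
End FTC.
End ImproperFTC.

(** * The weight and its moments *)

Section Weight.
Local Open Scope classical_set_scope.
Local Open Scope ring_scope.
Variable R : realType.
Notation mu := (@lebesgue_measure R).

Lemma is_derive_continuous (f : R -> R) (x df : R) :
  is_derive x 1 f df -> {for x, continuous f}.
Proof. by move=> [dfx _]; apply/differentiable_continuous/derivable1_diffP. Qed.

Lemma is_derive_onem_powR (a x : R) : x < 1 ->
  is_derive x 1 (fun y => (1 - y) `^ a) (- (a * (1 - x) `^ (a - 1))).
Proof.
move=> x1; have x1' : 0 < 1 - x by rewrite subr_gt0.
have d : is_derive x 1 (fun y : R => 1 - y) (- 1).
  by rewrite -[X in is_derive _ _ _ X]sub0r; apply: is_deriveB.
have := @is_derive1_comp R (@powR R ^~ a) (fun y => 1 - y) x _ _ (is_derive1_powR a x1') d.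
by rewrite mulrN1.
Qed.

Lemma onem_powR_cvg0 (a : R) : 0 < a -> (1 - x) `^ a @[x --> 1^'-] --> 0.
Proof.
move=> a0; apply/cvg_at_leftP => u [u1 ucvg].
have /cvg_at_rightP := powR_cvg0 a0; apply; split => [n|].
  by rewrite subr_gt0.
by rewrite -[X in _ --> X](subrr 1); apply: cvgB => //; exact: cvg_cst.
Qed.

Lemma is_derive1_inv (x : R) : x != 0 -> is_derive x 1 (fun y : R => y^-1) (- x ^- 2).
Proof.
move=> x0; have := @is_deriveV R id x 1 1 x0 (is_derive_id x 1).
by rewrite /GRing.scale /= mulr1.
Qed.

Lemma measurable_fun_cc (f : R -> R) : {in `]0, 1[, continuous f} ->
  measurable_fun (`[0, 1] : set R) (EFin \o f).
Proof.
by move=> cf; apply/measurable_EFinP; exact: measurable_fun_itv_cc (measurable_fun_oo cf).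
Qed.

Lemma integrable_powR (a : R) : 0 < a ->
  mu.-integrable `[0, 1] (EFin \o (fun y => y `^ (a - 1))).
Proof.
move=> a0; apply: integrable_oo_cc.
apply: (@ge0_derivative_integrable _ _ (fun y => a^-1 * y `^ a)).
- move=> x; rewrite in_itv /= => /andP[x0 x1].
  by apply: is_derive_continuous; exact: is_derive1_powR.
- move=> x; rewrite in_itv /= => /andP[x0 x1].
  have := @is_deriveZ _ _ _ (@powR R ^~ a) a^-1 x 1 _ (is_derive1_powR a x0).
  by rewrite /GRing.scale /= mulKf ?gt_eqF.
- rewrite powR0 ?gt_eqF //.
  by apply: cvgM; [exact: cvg_cst|exact: powR_cvg0].
- apply: cvgM; first exact: cvg_cst.
  apply: cvg_at_left_filter.
  exact: (is_derive_continuous (is_derive1_powR a ltr01)).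
- by move=> x _; exact: powR_ge0.
Qed.

Lemma integrable_onem_powR (a : R) : 0 < a ->
  mu.-integrable `[0, 1] (EFin \o (fun y => (1 - y) `^ (a - 1))).
Proof.
move=> a0; apply: integrable_oo_cc.
apply: (@ge0_derivative_integrable _ _ (fun y => - a^-1 * (1 - y) `^ a)).
- move=> x; rewrite in_itv /= => /andP[x0 x1].
  by apply: is_derive_continuous; exact: is_derive_onem_powR.
- move=> x; rewrite in_itv /= => /andP[x0 x1].
  have := @is_deriveZ _ _ _ (fun y : R => (1 - y) `^ a) (- a^-1) x 1 _
    (is_derive_onem_powR a x1).
  by rewrite /GRing.scale /= mulrNN mulKf ?gt_eqF.
- apply: cvgM; first exact: cvg_cst.
  apply: cvg_at_right_filter.
  exact: (is_derive_continuous (is_derive_onem_powR a ltr01)).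
- rewrite subrr powR0 ?gt_eqF //.
  by apply: cvgM; [exact: cvg_cst|exact: onem_powR_cvg0].
- by move=> x _; exact: powR_ge0.
Qed.

(** * Bounds, derivative and integrability of the weight *)

Section FixedParameters.
Variables alpha beta t : R.
Hypothesis alpha_gt0 : 0 < alpha.
Hypothesis beta_gt0 : 0 < beta.
Hypothesis t_ge0 : 0 <= t.
Let w := weight alpha beta t.

Lemma weight0 : w 0 = 0.
Proof. by rewrite /w /weight powR0 ?gt_eqF // mulr0 mul0r. Qed.

Lemma weight1 : w 1 = 0.
Proof. by rewrite /w /weight subrr powR0 ?gt_eqF // mulr0. Qed.

Lemma weight_ge0 y : 0 <= w y.
Proof. by rewrite !mulr_ge0 ?expR_ge0 ?powR_ge0. Qed.

Lemma weight_gt0 (y : R) : y \in `]0, 1[ -> 0 < w y.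
Proof.
rewrite in_itv /= => /andP[y0 y1].
by rewrite !mulr_gt0 ?expR_gt0 ?powR_gt0 // subr_gt0.
Qed.

Lemma expR_weight_le1 y : 0 <= y -> expR (- t / y) <= 1.
Proof. by move=> y0; rewrite -expR0 ler_expR mulNr oppr_le0 divr_ge0. Qed.

Lemma powR_le1 (a x : R) : 0 <= a -> 0 <= x <= 1 -> x `^ a <= 1.
Proof.
move=> a0 /andP[x0 x1]; have := ge0_ler_powR a0.
by move=> /(_ x 1); rewrite powR1; apply; rewrite ?nnegrE.
Qed.

Lemma weight_le_left y : 0 <= y <= 1 -> w y <= y `^ alpha.
Proof.
move=> /andP[y0 y1]; rewrite /w /weight -[leRHS]mulr1 -[y `^ alpha in leRHS]mul1r.
rewrite !ler_pM ?mulr_ge0 ?expR_ge0 ?powR_ge0 ?expR_weight_le1 //.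
by rewrite powR_le1 ?(ltW beta_gt0) // subr_ge0 y1 gerBl.
Qed.

Lemma weight_le_right y : 0 <= y <= 1 -> w y <= (1 - y) `^ beta.
Proof.
move=> /andP[y0 y1]; rewrite /w /weight -[leRHS]mul1r ler_pM ?mulr_ge0 ?expR_ge0 ?powR_ge0 //.
by rewrite mulr_ile1 ?expR_ge0 ?powR_ge0 ?expR_weight_le1 ?powR_le1 ?(ltW alpha_gt0) ?y0.
Qed.

Lemma is_derive_weight (y : R) : y \in `]0, 1[ ->
  is_derive y 1 w ((t / y ^+ 2 + alpha / y - beta / (1 - y)) * w y).
Proof.
rewrite in_itv /= => /andP[y0 y1]; have yN0 : y != 0 by rewrite gt_eqF.
have y1N0 : 1 - y != 0 by rewrite subr_eq0 gt_eqF.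
have dE : is_derive y 1 (fun x : R => expR (- t / x)) (expR (- t / y) * (t / y ^+ 2)).
  apply: (is_derive1_comp (is_derive_expR _)).
  have := is_deriveZ (- t) (is_derive1_inv yN0).
  by rewrite /GRing.scale /= mulrNN.
have := is_deriveM (is_deriveM dE (is_derive1_powR alpha y0)) (is_derive_onem_powR beta y1).
move=> d; apply: (is_derive_eq d).
rewrite /w /weight /GRing.scale /= !fctE.
(* Powers with exponent lowered by 1 become quotients, so that [field] sees the common factor
   [w y]. *)
rewrite !powRB ?yN0 ?y1N0 ?implybT // !powRr1 ?ltW ?subr_gt0 //.
by field; rewrite ?yN0 ?y1N0.
Qed.

Lemma continuous_weight : {in `]0, 1[, continuous w}.
Proof. by move=> y /is_derive_weight /is_derive_continuous. Qed.

Lemma integrable_weight_left :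
  mu.-integrable `[0, 1] (EFin \o (fun y => w y / y)).
Proof.
have mf := @measurable_fun_cc (fun y => w y / y).
apply: le_integrable (integrable_powR alpha_gt0) => //.
  apply: mf => y y01; apply: cvgM; first exact: continuous_weight.
  move: y01; rewrite in_itv /= => /andP[y0 _].
  by apply: (is_derive_continuous (is_derive1_inv _)); rewrite gt_eqF.
move=> y /=; rewrite in_itv /= => y01; have [y0 y1] := andP y01.
rewrite lee_fin !ger0_norm ?powR_ge0 ?divr_ge0 ?weight_ge0 //.
have [->|yN0] := eqVneq y 0; first by rewrite weight0 mul0r powR_ge0.
rewrite powRB ?yN0 ?implybT // powRr1 // ler_pM2r ?invr_gt0 ?lt_neqAle 1?eq_sym ?yN0 //.
exact: weight_le_left.
Qed.

Lemma integrable_weight_right :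
  mu.-integrable `[0, 1] (EFin \o (fun y => w y / (1 - y))).
Proof.
have mf := @measurable_fun_cc (fun y => w y / (1 - y)).
apply: le_integrable (integrable_onem_powR beta_gt0) => //.
  apply: mf => y y01; apply: cvgM; first exact: continuous_weight.
  move: y01; rewrite in_itv /= => /andP[_ y1].
  apply: cvgV; first by rewrite subr_eq0 gt_eqF.
  by apply: cvgB; [exact: cvg_cst|exact: cvg_id].
move=> y /=; rewrite in_itv /= => y01; have [y0 y1] := andP y01.
have y1' : 0 <= 1 - y by rewrite subr_ge0.
rewrite lee_fin !ger0_norm ?powR_ge0 ?divr_ge0 ?weight_ge0 //.
have [->|yN1] := eqVneq y 1; first by rewrite weight1 mul0r powR_ge0.
have y1N0 : 1 - y != 0 by rewrite subr_eq0 eq_sym.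
rewrite powRB ?y1N0 ?implybT // powRr1 // ler_pM2r ?invr_gt0 ?lt_neqAle 1?eq_sym ?y1N0 //.
exact: weight_le_right.
Qed.
End FixedParameters.
End Weight.

(** * Moments as linear functionals on polynomials *)

Section Moment.
Local Open Scope classical_set_scope.
Local Open Scope ring_scope.
Variable R : realType.
Notation mu := (@lebesgue_measure R).
Implicit Types (v : R -> R) (p : {poly R}).

Definition moment v p := integral01 (fun y => p.[y] * v y).

Lemma integrable_horner v p :
  mu.-integrable `[0, 1] (EFin \o v) ->
  mu.-integrable `[0, 1] (EFin \o (fun y => p.[y] * v y)).
Proof.
move=> iv.
have := @integrableMr _ (measurableTypeR R) R mu _ (measurable_itv `[0%R, 1%R])
  (horner p) (EFin \o v) _ _ iv; apply.
  exact: measurable_poly.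
have : bounded_set (horner p @` `[0, 1]).
  apply: compact_bounded; apply: continuous_compact; last exact: segment_compact.
  by apply: continuous_subspaceT; exact: continuous_horner.
move=> [M [Mreal HM]]; exists M; split => // x Mx y /= y01.
by apply: (HM x Mx); exists y.
Qed.

Lemma moment_is_scalar v :
  mu.-integrable `[0, 1] (EFin \o v) -> scalar (moment v).
Proof.
move=> iv c p q; rewrite /moment /integral01.
under eq_Rintegral do rewrite hornerD hornerZ mulrDl -mulrA.
rewrite RintegralD //; first by rewrite RintegralZl //; exact: integrable_horner.
  apply: (@integrableZl _ _ _ mu _ _ c (fun y => (p.[y] * v y)%:E)) => //.
  exact: integrable_horner.
exact: integrable_horner.
Qed.

Lemma scalar_scale (c : R) (f : {poly R} -> R) :
  scalar f -> scalar (fun p => c * f p).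
Proof. by move=> sf d p q; rewrite sf; ring. Qed.

(** This bundles the moments into the linear forms over which the algebraic section is stated. *)
Lemma scalar_packed (f : {poly R} -> R) : scalar f ->
  exists g : {scalar {poly R}}, g =1 f.
Proof.
move=> sf.
by exists (HB.pack_for {scalar {poly R}} f (GRing.isLinear.Build R {poly R} R *%R f sf)).
Qed.

Lemma negligible_roots p : p != 0 -> mu.-negligible [set x | root p x].
Proof.
move=> p0; have roots_fin : finite_set [set x | root p x].
  (* An infinite root set would contain [size p] distinct roots, more than the degree allows. *)
  apply: contrapT => /(infinite_set_fset (size p))[B subB]; apply/negP.
  rewrite -ltnNge max_poly_roots // ?finmap.fset_uniq //.
  by apply/allP => x xB; exact: subB.
have roots_count := finite_set_countable roots_fin.
apply/negligibleP; last exact: countable_lebesgue_measure0.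
by apply: countable_measurable => // x; exact: measurable_set1.
Qed.

Section FixedParameters.
Variables alpha beta t : R.
Hypothesis alpha_gt0 : 0 < alpha.
Hypothesis beta_gt0 : 0 < beta.
Hypothesis t_ge0 : 0 <= t.
Let w := weight alpha beta t.
Let wl y := w y / y.
Let wr y := w y / (1 - y).

Lemma weight_left_mul y : y * wl y = w y.
Proof.
have [->|y0] := eqVneq y 0; first by rewrite mul0r /w weight0.
by rewrite /wl mulrC divfK.
Qed.

Lemma weight_right_mul y : (1 - y) * wr y = w y.
Proof.
have [->|y1] := eqVneq y 1; first by rewrite subrr mul0r /w weight1.
by rewrite /wr mulrC divfK // subr_eq0 eq_sym.
Qed.

Lemma moment_left_X p : moment wl ('X * p) = moment w p.
Proof.
congr integral01; apply/funext => y; rewrite -[in RHS]weight_left_mul.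
by rewrite hornerM hornerX; ring.
Qed.

Lemma moment_right_1X p : moment wr ((1 - 'X) * p) = moment w p.
Proof.
congr integral01; apply/funext => y; rewrite -[in RHS]weight_right_mul.
have -> : ((1 - 'X) * p).[y] = (1 - y) * p.[y] by rewrite !hornerE.
by ring.
Qed.

Lemma integrable_weight : mu.-integrable `[0, 1] (EFin \o w).
Proof.
have := integrable_horner 'X (integrable_weight_left alpha_gt0 beta_gt0 t_ge0).
congr (integrable _ _ _); apply/funext => y /=.
by rewrite hornerX weight_left_mul.
Qed.

Lemma weight_cvg_left : w y @[y --> 0^'+] --> 0.
Proof.
apply: (@squeeze_cvgr _ _ _ _ (cst 0) (fun y => y `^ alpha)).
- near=> y; rewrite weight_ge0 weight_le_left //; apply/andP; split.
    by near: y; exact: nbhs_right_ge.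
  by near: y; exact: nbhs_right_le.
- exact: cvg_cst.
- exact: powR_cvg0.
Unshelve. all: by end_near. Qed.

Lemma weight_cvg_right : w y @[y --> 1^'-] --> 0.
Proof.
apply: (@squeeze_cvgr _ _ _ _ (cst 0) (fun y => (1 - y) `^ beta)).
- near=> y; rewrite weight_ge0 weight_le_right //; apply/andP; split.
    by near: y; exact: nbhs_left_ge.
  by near: y; exact: nbhs_left_le.
- exact: cvg_cst.
- exact: onem_powR_cvg0.
Unshelve. all: by end_near. Qed.

Lemma moment_pearson p :
  moment w (p + 'X * p^`()) + t * moment wl p + (alpha + beta) * moment w p =
  beta * moment wr p.
Proof.
(* This is the derivative of [F], split into integrable pieces; [alpha + beta] arises from
   [y / (1 - y) = 1 / (1 - y) - 1]. *)
pose f y := (p + 'X * p^`()).[y] * w y + t * (p.[y] * wl y)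
  + (alpha + beta) * (p.[y] * w y) - beta * (p.[y] * wr y).
pose F y := ('X * p).[y] * w y.
have iw := integrable_weight.
have iwl := integrable_weight_left alpha_gt0 beta_gt0 t_ge0.
have iwr := integrable_weight_right alpha_gt0 beta_gt0 t_ge0.
have i1 := integrable_horner (p + 'X * p^`()) iw.
have i2 := @integrableZl _ _ _ mu _ (measurable_itv _) t _ (integrable_horner p iwl).
have i3 := @integrableZl _ _ _ mu _ (measurable_itv _) (alpha + beta) _
  (integrable_horner p iw).
have i4 := @integrableZl _ _ _ mu _ (measurable_itv _) beta _ (integrable_horner p iwr).
have i12 := @integrableD _ _ _ mu _ (measurable_itv _) _ _ i1 i2.
have i123 := @integrableD _ _ _ mu _ (measurable_itv _) _ _ i12 i3.
have fi : mu.-integrable `[0, 1] (EFin \o f).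
  exact: (@integrableB _ _ _ mu _ (measurable_itv _) _ _ i123 i4).
have df : {in `]0, 1[, forall y : R, is_derive y 1 F (f y)}.
  move=> y y01; have := is_deriveM (is_derive_poly ('X * p) y)
    (is_derive_weight alpha beta t y01).
  move=> d; apply: (is_derive_eq d).
  move: y01; rewrite in_itv /= => /andP[y0 y1].
  rewrite /GRing.scale /= derivM derivX mul1r /f /wl /wr -/w !hornerD.
  have hX q : ('X * q).[y] = y * q.[y] by rewrite hornerM hornerX.
  rewrite !hX; move: (w y) => wy; field.
  by rewrite subr_eq0 !gt_eqF.
have F0 : F y @[y --> 0^'+] --> F 0.
  rewrite /F /w weight0 //; apply: cvgM; last exact: weight_cvg_left.
  by apply: cvg_at_right_filter; exact: continuous_horner.
have F1 : F y @[y --> 1^'-] --> F 1.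
  rewrite /F /w weight1 //; apply: cvgM; last exact: weight_cvg_right.
  by apply: cvg_at_left_filter; exact: continuous_horner.
have cf : {in `]0, 1[, continuous f}.
  move=> y y01; have cw : {for y, continuous w} by exact: continuous_weight.
  have ch (q : {poly R}) : {for (y : R), continuous (horner q : R -> R)}.
    exact: continuous_horner.
  move: y01; rewrite in_itv /= => /andP[y0 y1].
  have cl : {for y, continuous wl}.
    apply: cvgM => //; apply: cvgV; first by rewrite gt_eqF.
    exact: cvg_id.
  have cr : {for y, continuous wr}.
    apply: cvgM => //; apply: cvgV; first by rewrite subr_eq0 gt_eqF.
    by apply: cvgB; [exact: cvg_cst|exact: cvg_id].
  by apply: cvgB; [apply: cvgD; [apply: cvgD|]|];
    do ?[exact: cw | exact: cl | exact: cr | exact: ch | exact: cvg_cst | apply: cvgM].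
have if_oo : mu.-integrable (`]0, 1[ : set R) (EFin \o f).
  by apply: integrableS fi => //; exact: subset_itv_oo_cc.
have intf : integral01 f = 0.
  rewrite /integral01 /Rintegral integral_itv_bndoo; last exact: measurable_int if_oo.
  rewrite (improper_FTC cf df F0 F1 if_oo) /= /F /w weight0 // weight1 //.
  by rewrite !mulr0 subrr.
apply/eqP; rewrite -subr_eq0 -intf; apply/eqP.
rewrite /f /integral01 RintegralB // RintegralD // RintegralD //.
by rewrite !RintegralZl //; exact: integrable_horner.
Qed.

(** If the integral of this nonnegative function were 0, it would vanish almost everywhere. Since
    [w > 0] inside, the open interval would then be negligible, being covered by a null set and the
    roots of [p]. This yields [h n != 0]. *)
Lemma moment_square_neq0 p : p != 0 -> moment w (p * p) != 0.
Proof.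
move=> p0; apply/eqP => m0.
have iw := integrable_horner (p * p) integrable_weight.
have nng x : 0 <= (p * p).[x] * w x.
  by rewrite hornerM mulr_ge0 ?weight_ge0 // -expr2 sqr_ge0.
have : (\int[mu]_(x in `[0%R, 1%R]) `|((p * p).[x] * w x)%:E| = 0)%E.
  under eq_integral => x _ do rewrite gee0_abs ?lee_fin //.
  rewrite -[LHS]fineK ?integrable_fin_num //.
  by congr (_%:E); exact: m0.
move=> /(ae_eq_integral_abs mu (measurable_itv _) (measurable_int _ iw)).
move=> ae0; have neg := negligibleU ae0 (negligible_roots p0).
have : mu.-negligible (`]0%R, 1%R[ : set R).
  apply: negligibleS neg => x x01.
  have [px|px] := boolP (root p x); [by right|left => /= /(_ (subset_itv_oo_cc x01)) [] /eqP].
  rewrite hornerM mulf_eq0 mulf_eq0 orbb -rootE (negPf px) /=.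
  by rewrite gt_eqF // weight_gt0.
move=> neg01; have : mu (`]0%R, 1%R[ : set R) = 0 by apply: measure_negligible.
by rewrite lebesgue_measure_itv /= lte_fin ltr01 oppr0 adde0 => -[] /eqP; rewrite oner_eq0.
Qed.
End FixedParameters.
End Moment.

(** * Transfer of the algebraic identities to the integrals *)

Theorem proposition2p5 (R : realType) (alpha beta t : R)
    (halpha : 0 < alpha) (hbeta : 0 < beta) (ht : 0 <= t)
    (P : nat -> {poly R}) (h a b : nat -> R)
    (hP : monic_orthogonal (weight alpha beta t) P h)
    (hrec : three_term_recurrence P a b) (n : nat) :
  let Rs := Rstar alpha beta t P h in
  let Ra := Raux alpha beta t P h in
  let rs := rstar alpha beta t P h in
  let ra := raux alpha beta t P h in
  [/\ rs n ^+ 2 - t * rs n = b n * Rs n * previous Rs n,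
      ra n ^+ 2 + beta * ra n = b n * Ra n * previous Ra n,
      (t - 2 * rs n) * (n%:R - ra n) - alpha * rs n =
        b n * (Rs n * previous Ra n + previous Rs n * Ra n)
    & \sum_(0 <= j < n) Rs j =
        n%:R * (t - alpha - n%:R)
        - (2 * n%:R + alpha + beta) * (rs n - ra n)].
Proof.
have iw := integrable_weight halpha hbeta ht.
have il := integrable_weight_left halpha hbeta ht.
have ir := integrable_weight_right halpha hbeta ht.
have [L LE] := scalar_packed (moment_is_scalar iw).
have [T TE] := scalar_packed (scalar_scale t (moment_is_scalar il)).
have [S SE] := scalar_packed (scalar_scale beta (moment_is_scalar ir)).
case: hP => P_monic size_P orthP.
have orthL i j : L (P i * P j) = h j * (i == j)%:R.
  rewrite LE -orthP; congr integral01; apply/funext => y.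
  by rewrite hornerM.
have h_neq0 j : h j != 0.
  have := moment_square_neq0 halpha hbeta ht (monic_neq0 (P_monic j)).
  by rewrite -LE orthL eqxx mulr1.
have T_X p : T ('X * p) = t * L p by rewrite TE LE moment_left_X.
have S_1X p : S ((1 - 'X) * p) = beta * L p by rewrite SE LE moment_right_1X.
have pearson p : L (p + 'X * p^`()) + T p + (alpha + beta) * L p = S p.
  by rewrite TE SE !LE moment_pearson.
(* The four auxiliary quantities are matched with their algebraic counterparts by moving the
   prefactor inside the functional. *)
have RsE : Rstar alpha beta t P h = fun j => T (P j * P j) / h j.
  apply/funext => j; rewrite TE /Rstar mulrAC; congr (_ * _ / _).
  by congr integral01; apply/funext => y; rewrite hornerM -[LHS]mulrA.
have RaE : Raux alpha beta t P h = fun j => S (P j * P j) / h j.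
  apply/funext => j; rewrite SE /Raux mulrAC; congr (_ * _ / _).
  by congr integral01; apply/funext => y; rewrite hornerM -[LHS]mulrA.
have rsE : rstar alpha beta t P h =
    fun j => if j is i.+1 then T (P j * P i) / h i else 0.
  apply/funext => -[//|j]; rewrite TE /rstar mulrAC; congr (_ * _ / _).
  by congr integral01; apply/funext => y; rewrite hornerM -[LHS]mulrA [_ * (P j).[y]]mulrC.
have raE : raux alpha beta t P h =
    fun j => if j is i.+1 then S (P j * P i) / h i else 0.
  apply/funext => -[//|j]; rewrite SE /raux mulrAC; congr (_ * _ / _).
  by congr integral01; apply/funext => y; rewrite hornerM -[LHS]mulrA [_ * (P j).[y]]mulrC.
rewrite /= RsE RaE rsE raE; split.
- exact: (rstar_quadratic P_monic size_P orthL h_neq0 hrec T_X).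
- exact: (raux_quadratic P_monic size_P orthL h_neq0 hrec S_1X).
- exact: (mixed_identity P_monic size_P orthL h_neq0 hrec T_X S_1X pearson).
- exact: (sum_Rstar P_monic size_P orthL h_neq0 hrec T_X S_1X pearson).
Qed.
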